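(* Let $p$ be an odd prime, let $q\in\mathbb{C}_p$ with $|1-q|_p<p^{-1/(p-1)}$, and let $h\in\mathbb{N}$. Let $n_1,n_2,k\in\mathbb{N}^{\ast}$ with $n_1+n_2>2k$. Then $$\int_{\mathbb{Z}_p}B_{k,n_1}(x,q)B_{k,n_2}(x,q)\,q^{(h-1)x}\,d\mu_{-q}(x)=\begin{cases}[2]_q+\dfrac{q^{h+1}}{n_1+n_2+1}G_{n_1+n_2+1,q^{-1}}^{(h)} & \text{if } k=0,\\[2mm] \displaystyle\binom{n_1}{k}\binom{n_2}{k}\sum_{l=0}^{2k}\binom{2k}{l}(-1)^{2k+l}\left([2]_q+\frac{q^{h+1}}{n_1+n_2-l+1}G_{n_1+n_2-l+1,q^{-1}}^{(h)}\right) & \text{if } k\neq0.\end{cases}$$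
   Context: Here $\mathbb{N}=\{1,2,\dots\}$, $\mathbb{N}^{\ast}=\mathbb{N}\cup\{0\}$; $\mathbb{C}_p$ is the completion of an algebraic closure of $\mathbb{Q}_p$ with absolute value normalized by $|p|_p=p^{-1}$. For $|x|_p\le 1$, $q^x=\exp(x\log q)$. Put $[x]_q=\frac{1-q^x}{1-q}$ (with $[x]_1=x$), so $[2]_q=1+q$, and $[x]_{-q}=\frac{1-(-q)^x}{1+q}$ for $x\in\mathbb{N}$. The fermionic $p$-adic $q$-integral of a uniformly differentiable $f:\mathbb{Z}_p\to\mathbb{C}_p$ is $$\int_{\mathbb{Z}_p}f(x)\,d\mu_{-q}(x)=\lim_{N\to\infty}\frac{1}{[p^N]_{-q}}\sum_{x=0}^{p^N-1}(-1)^xf(x)q^x.$$ The $(h,q)$-Genocchi polynomials are defined by $G_{0,q}^{(h)}(x)=0$ and $\frac{G_{n+1,q}^{(h)}(x)}{n+1}=\int_{\mathbb{Z}_p}q^{(h-1)y}[x+y]_q^n\,d\mu_{-q}(y)$ for $n\in\mathbb{N}^{\ast}$, $x\in\mathbb{Z}_p$; the $(h,q)$-Genocchi numbers are $G_{n,q}^{(h)}=G_{n,q}^{(h)}(0)$. $G_{n,q^{-1}}^{(h)}$ is obtained by replacing $q$ by $q^{-1}$ throughout. For $n,k\in\mathbb{N}^{\ast}$ and $x\in\mathbb{Z}_p$, the $q$-Bernstein polynomials are $B_{k,n}(x,q)=\binom{n}{k}[x]_q^k[1-x]_{q^{-1}}^{n-k}$ (with $\binom{n}{k}=0$ and $B_{k,n}=0$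 if $k>n$). *)

(* Defs.v *)
From HB Require Import structures.
From mathcomp Require Import all_boot all_order all_algebra.
From mathcomp Require Import all_classical all_reals all_analysis.
Set Implicit Arguments.
Unset Strict Implicit.
Unset Printing Implicit Defensive.
Import Order.TTheory GRing.Theory Num.Theory.
Import numFieldNormedType.Exports.
Local Open Scope classical_set_scope.
Local Open Scope ring_scope.

(* Fields with a non-Archimedean absolute value.  The normed structures of the
   library do not apply: they require `|x *+ n| = `|x| *+ n, which fails
   p-adically. *)
Record valuedField (R : realType) := ValuedField {
  vf_field : fieldType ;
  vf_abs : vf_field -> R ;
  vf_abs_ge0 : forall x, 0 <= vf_abs x ;
  vf_abs_eq0 : forall x, vf_abs x = 0 <-> x = 0 ;
  vf_absM : forall x y, vf_abs (x * y) = vf_abs x * vf_abs y ;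
  vf_abs_ultra : forall x y, vf_abs (x + y) <= Num.max (vf_abs x) (vf_abs y)
}.

(* The carrier, as a type with both the field structure and the metric
   |x - y|, so that cvg, lim, dense and cauchy are those of this metric. *)
Definition vf_sort (R : realType) (K : valuedField R) : Type := vf_field K.
Coercion vf_sort : valuedField >-> Sortclass.

HB.instance Definition _ (R : realType) (K : valuedField R) :=
  GRing.Field.copy (vf_sort K) (vf_field K).
HB.instance Definition _ (R : realType) (K : valuedField R) :=
  isPointed.Build (vf_sort K) 0.

Definition absv (R : realType) (K : valuedField R) (x : K) : R := vf_abs x.

Section Metric.
Variables (R : realType) (K : valuedField R).
Implicit Types x y z : K.

Let dist x y : R := absv (x - y).

Lemma absv1 : absv (1 : K) = 1.
Proof.
have n0 : absv (1 : K) != 0 by apply/eqP => /vf_abs_eq0/eqP; rewrite oner_eq0.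
by apply: (mulfI n0); rewrite mulr1 /absv -vf_absM mulr1.
Qed.

Lemma absvN x : absv (- x) = absv x.
Proof.
rewrite -mulN1r /absv vf_absM -[RHS]mul1r; congr (_ * _).
apply/eqP; rewrite -(@eqrXn2 _ 2) ?vf_abs_ge0 // expr1n expr2 -vf_absM mulN1r opprK.
exact/eqP/absv1.
Qed.

Let distxx x : dist x x = 0.
Proof. by rewrite /dist subrr; apply/vf_abs_eq0. Qed.

Let dist_positivity x y : dist x y = 0 -> x = y.
Proof. by move/vf_abs_eq0/eqP; rewrite subr_eq0 => /eqP. Qed.

Let dist_sym x y : dist x y = dist y x.
Proof. by rewrite /dist -absvN opprB. Qed.

Let dist_triangle y x z : dist x z <= dist x y + dist y z.
Proof.
have -> : dist x z = absv ((x - y) + (y - z)) by rewrite addrA subrK.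
apply: (le_trans (vf_abs_ultra _ _)).
by rewrite ge_max lerDl lerDr !vf_abs_ge0.
Qed.

HB.instance Definition _ :=
  isMetric.Build R (vf_sort K) distxx dist_positivity dist_sym dist_triangle.

End Metric.

Definition complete_space (T : puniformType) :=
  forall F : set_system T, ProperFilter F -> cauchy F -> cvg F.

Definition padic_absv (R : realType) (p : nat) (x : rat) : R :=
  if x == 0 then 0
  else p%:R ^+ logn p `|denq x|%N / p%:R ^+ logn p `|numq x|%N.

(* The p-adic complex numbers, given by the chain Q -> Qp -> Qpbar -> Cp:
   completion of Q at p, algebraic closure, completion.  These data exist and
   are unique up to isometric isomorphism of Cp. *)
Record padic_complex (R : realType) (p : nat) := PadicComplex {
  Qp : valuedField R ;
  Qp_absv : forall x : rat, absv (ratr x : Qp) = padic_absv R p x ;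
  Qp_dense : dense (range (ratr : rat -> Qp)) ;
  Qp_complete : complete_space Qp ;
  Qpbar : valuedField R ;
  Qp_to_Qpbar : {rmorphism Qp -> Qpbar} ;
  Qpbar_absv : forall x, absv (Qp_to_Qpbar x) = absv x ;
  Qpbar_algebraic : forall z, algebraicOver Qp_to_Qpbar z ;
  Qpbar_closed : GRing.closed_field_axiom Qpbar ;
  Cp :> valuedField R ;
  Qpbar_to_Cp : {rmorphism Qpbar -> Cp} ;
  Cp_absv : forall x, absv (Qpbar_to_Cp x) = absv x ;
  Cp_dense : dense (range Qpbar_to_Cp) ;
  Cp_complete : complete_space Cp
}.

Section Genocchi.
Context {R : realType} {p : nat} {C : padic_complex R p}.
Implicit Types (q x y z : C) (f : C -> C) (h k n : nat).

Definition pexp z : C := limn (series (fun n => z ^+ n / n`!%:R)).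

Definition plog z : C :=
  limn (series (fun n => (-1) ^+ n * (z - 1) ^+ n.+1 / n.+1%:R)).

Definition qpow q x : C := pexp (x * plog q).

Definition qnum q x : C := if q == 1 then x else (1 - qpow q x) / (1 - q).

(* [m]_{-q}, for a natural number m *)
Definition qnumN q (m : nat) : C := (1 - (- q) ^+ m) / (1 + q).

(* Functions on Z_p are represented by functions on Cp, of which only the
   values on Z_p (indeed on the natural numbers) matter.  The limit exists when
   f is uniformly differentiable on Z_p. *)
Definition fermionic_int q f : C :=
  limn (fun N : nat =>
    (qnumN q (p ^ N)%N)^-1 *
    \sum_(0 <= x < (p ^ N)%N) (-1) ^+ x * f x%:R * q ^+ x).

(* h.-1 is the intended h - 1 only for 0 < h *)
Definition genocchi_poly h q n x : C :=
  if n is m.+1 then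
    m.+1%:R * fermionic_int q (fun y => qpow q (h.-1%:R * y) * qnum q (x + y) ^+ m)
  else 0.

Definition genocchi h q n : C := genocchi_poly h q n 0.

(* vanishes for n < k, because 'C(n, k) does *)
Definition qbernstein k n x q : C :=
  'C(n, k)%:R * qnum q x ^+ k * qnum q^-1 (1 - x) ^+ (n - k).

End Genocchi.

(* Main.v *)
Require Import Defs.
From mathcomp Require Import all_boot all_order all_algebra.
From mathcomp Require Import all_classical all_reals all_analysis.
From mathcomp Require Import ring zify.
Import Order.TTheory GRing.Theory Num.Theory.
Import numFieldNormedType.Exports.
Local Open Scope classical_set_scope.
Local Open Scope ring_scope.

(** At a natural number x all powers are ordinary ones, and
    [1 - x]_{1/q} = 1 - [x]_q. Writing b = 1 - [x]_q, the product of the two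
    Bernstein polynomials is therefore C(n1,k) C(n2,k) (1 - b)^(2k)
    b^(n1+n2-2k), and the binomial theorem turns it into a combination of the
    powers b^(n1+n2-l) for l <= 2k. By linearity the theorem reduces to the
    integrals of q^((h-1)x) b^m with m > 0 (for k = 0 the sum over l has the
    single term l = 0, so both cases of the formula agree).

    Up to the factor (1 + q)/2, which is the limit of 1/[p^N]_{-q}, such an
    integral is the limit J(g) of the sums of (-1)^x g(x) over x < p^N, where
    g(x) = q^(hx) (1 - [x]_q)^m. These sums converge as soon as g is Lipschitz
    (lemma cvg_altsum). As p^N is odd, the reflection x |-> p^N - 1 - x
    preserves the signs; since q^(p^N) tends to 1, it carries g to
    q^h phi(y + 2) in the limit, where phi(y) = q^(-hy) [y]_{1/q}^m is the
    function whose J is the Genocchi number with parameter 1/q (lemma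
    cvg_altsum_reflect). Finally J(g o S) = 2 g(0) - J(g) (lemma
    cvg_altsum_shift) is applied twice to return from phi(y + 2) to phi(y); it
    leaves the term 2 q^h phi(1) = 2, which becomes [2]_q.

    All this needs exp (n log q) = q^n. The exponential series is additive on
    the disc of radius r = p^(-1/(p-1)), because r^(n-1) <= |n!| (lemma pexpD).
    That exp (log q) = q (lemma pexp_plog) is obtained without composing power
    series, by comparing the powers of both sides with exponent M = p^N: each
    of them is 1 + M log q up to an error that is small compared with M,
    whereas |u^M - 1| = |M| |u - 1| for u in the disc around 1. *)

Set Implicit Arguments.
Unset Strict Implicit.
Unset Printing Implicit Defensive.

(** * Non-Archimedean absolute values and convergence *)

Section AbsoluteValue.
Variables (R : realType) (K : valuedField R).
Implicit Types x y z : K.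

Lemma absv_ge0 x : 0 <= absv x.
Proof. exact: vf_abs_ge0. Qed.

Lemma absv0 : absv (0 : K) = 0.
Proof. exact/vf_abs_eq0. Qed.

Lemma absv_eq0 x : (absv x == 0) = (x == 0).
Proof. by apply/eqP/eqP => /vf_abs_eq0. Qed.

Lemma absv_gt0 x : (0 < absv x) = (x != 0).
Proof. by rewrite lt_neqAle absv_ge0 andbT eq_sym absv_eq0. Qed.

Lemma absvM x y : absv (x * y) = absv x * absv y.
Proof. exact: vf_absM. Qed.

Lemma absvX x n : absv (x ^+ n) = absv x ^+ n.
Proof. by elim: n => [|n IH]; rewrite ?expr0 ?absv1// !exprS absvM IH. Qed.

Lemma absvV x : absv x^-1 = (absv x)^-1.
Proof.
have [->|x0] := eqVneq x 0; first by rewrite invr0 absv0 invr0.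
have ax0 : absv x != 0 by rewrite absv_eq0.
by apply: (mulfI ax0); rewrite -absvM !divff// absv1.
Qed.

Lemma absv_distC x y : absv (x - y) = absv (y - x).
Proof. by rewrite -absvN opprB. Qed.

Lemma absvD_le x y (b : R) : absv x <= b -> absv y <= b -> absv (x + y) <= b.
Proof. by move=> xb yb; rewrite (le_trans (vf_abs_ultra _ _))// ge_max xb. Qed.

Lemma absvD_lt x y (b : R) : absv x < b -> absv y < b -> absv (x + y) < b.
Proof. by move=> xb yb; rewrite (le_lt_trans (vf_abs_ultra _ _))// gt_max xb. Qed.

Lemma absvB_le x y (b : R) : absv x <= b -> absv y <= b -> absv (x - y) <= b.
Proof. by move=> xb yb; rewrite absvD_le// absvN. Qed.

Lemma absv_sum_le (I : Type) (s : seq I) (P : pred I) (F : I -> K) (b : R) :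
  0 <= b -> (forall i, P i -> absv (F i) <= b) ->
  absv (\sum_(i <- s | P i) F i) <= b.
Proof.
move=> b0 Fb; elim/big_rec: _ => [|i x Pi xb]; first by rewrite absv0.
by rewrite absvD_le ?Fb.
Qed.

Lemma absv_sum_nat_le m n (F : nat -> K) (b : R) :
  0 <= b -> (forall i, (m <= i < n)%N -> absv (F i) <= b) ->
  absv (\sum_(m <= i < n) F i) <= b.
Proof. by move=> b0 Fb; rewrite big_nat; exact: absv_sum_le. Qed.

(** Otherwise x = (x + y) - y would be smaller than itself. *)
Lemma absvD_dominant x y : absv y < absv x -> absv (x + y) = absv x.
Proof.
move=> yx; apply/eqP; rewrite eq_le absvD_le ?(ltW yx)//= leNgt.
apply/negP => xyx; have := absvD_lt xyx (_ : absv (- y) < absv x).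
by rewrite addrK absvN ltxx => /(_ yx).
Qed.

Lemma absv_unit x : absv (1 - x) < 1 -> absv x = 1.
Proof.
move=> x1; rewrite -[in LHS](subKr 1 x) absvD_dominant ?absv1//.
by rewrite absvN.
Qed.

Lemma absv_nat_le1 n : absv (n%:R : K) <= 1.
Proof.
elim: n => [|n IH]; first by rewrite absv0 ler01.
by rewrite -addn1 natrD absvD_le// absv1.
Qed.

Lemma absv_sign n : absv ((-1) ^+ n : K) = 1.
Proof. by rewrite absvX absvN absv1 expr1n. Qed.

Lemma absvX_le1 x n : absv x <= 1 -> absv (x ^+ n) <= 1.
Proof. by move=> x1; rewrite absvX exprn_ile1 ?absv_ge0. Qed.

Lemma absvM_le1 x y : absv x <= 1 -> absv y <= 1 -> absv (x * y) <= 1.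
Proof. by move=> x1 y1; rewrite absvM mulr_ile1 ?absv_ge0. Qed.

Lemma absvM_le x y (b : R) : absv x <= 1 -> absv y <= b -> absv (x * y) <= b.
Proof.
move=> x1 yb; rewrite absvM (le_trans _ yb)//.
by rewrite ler_piMl ?absv_ge0.
Qed.

End AbsoluteValue.

Section Convergence.
Variables (R : realType) (K : valuedField R).
Implicit Types (u v : nat -> K) (a b l : K).

Lemma cvg_absvP u l :
  u @ \oo --> l <-> (fun n => absv (u n - l)) @ \oo --> (0 : R).
Proof.
split=> [/cvg_ballP ul|/cvgrPdist_lt ul].
  apply/cvgrPdist_lt => e e0; apply: filterS (ul e e0) => n.
  rewrite ballEmdist/= sub0r normrN (ger0_norm (absv_ge0 _)).
  by rewrite absv_distC.
apply/cvg_ballP => e e0; apply: filterS (ul e e0) => n.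
by rewrite ballEmdist/= sub0r normrN (ger0_norm (absv_ge0 _)) absv_distC.
Qed.

Lemma limnE u l : u @ \oo --> l -> limn u = l.
Proof. exact/cvg_lim/metric_hausdorff. Qed.

Lemma cvg_absv_le u l (c : nat -> R) :
  (forall n, absv (u n - l) <= c n) -> c @ \oo --> (0 : R) -> u @ \oo --> l.
Proof.
move=> uc c0; apply/cvg_absvP.
apply: (squeeze_cvgr _ (@cvg_cst _ 0 _ _ _) c0).
by apply: nearW => n; rewrite absv_ge0/=.
Qed.

Lemma cvg_absvD u v a b :
  u @ \oo --> a -> v @ \oo --> b -> (fun n => u n + v n) @ \oo --> a + b.
Proof.
move=> /cvg_absvP ua /cvg_absvP vb.
apply: (@cvg_absv_le _ _ (fun n => absv (u n - a) + absv (v n - b))); last first.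
  by rewrite -[0]addr0; exact: cvgD.
move=> n; rewrite opprD addrACA absvD_le// ?lerDl ?lerDr ?absv_ge0//.
Qed.

Lemma cvg_absv_bounded u a : u @ \oo --> a ->
  exists2 c : R, 0 < c & \forall n \near \oo, absv (u n) <= c.
Proof.
move=> /cvg_absvP/cvgrPdist_lt/(_ 1 ltr01) ua.
exists (absv a + 1); first by rewrite ltr_wpDl ?absv_ge0.
apply: filterS ua => n; rewrite sub0r normrN (ger0_norm (absv_ge0 _)) => un.
rewrite -(subrK a (u n)) absvD_le ?lerDl//.
by rewrite (le_trans (ltW un))// lerDr absv_ge0.
Qed.

Lemma cvg_absvM u v a b :
  u @ \oo --> a -> v @ \oo --> b -> (fun n => u n * v n) @ \oo --> a * b.
Proof.
move=> ua vb; have [c c0 uc] := cvg_absv_bounded ua.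
move: ua vb => /cvg_absvP ua /cvg_absvP vb; apply/cvg_absvP.
apply: (squeeze_cvgr (f := fun=> 0)
  (h := fun n => c * absv (v n - b) + absv b * absv (u n - a))).
- apply: filterS uc => n uc; rewrite absv_ge0/=.
  have -> : u n * v n - a * b = u n * (v n - b) + b * (u n - a) by ring.
  rewrite absvD_le// absvM.
    rewrite -[leLHS]addr0 lerD ?mulr_ge0 ?absv_ge0//.
    by rewrite ler_wpM2r ?absv_ge0.
  by rewrite lerDr mulr_ge0 ?absv_ge0// ltW.
- exact: cvg_cst.
- have -> : 0 = c * 0 + absv b * 0 by rewrite !mulr0 addr0.
  by apply: cvgD; exact: cvgMr.
Qed.

Lemma cvg_absvMl c u a : u @ \oo --> a -> (fun n => c * u n) @ \oo --> c * a.
Proof. by apply: cvg_absvM; exact: cvg_cst. Qed.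

Lemma cvg_absvB u v a b :
  u @ \oo --> a -> v @ \oo --> b -> (fun n => u n - v n) @ \oo --> a - b.
Proof.
move=> ua vb; apply: cvg_absvD => //.
under eq_fun do rewrite -(mulN1r (v _)).
by rewrite -(mulN1r b); exact: cvg_absvMl.
Qed.

Lemma cvg_absv_sum (I : Type) (s : seq I) (F : I -> nat -> K) (l : I -> K) :
  (forall i, F i @ \oo --> l i) ->
  (fun n => \sum_(i <- s) F i n) @ \oo --> \sum_(i <- s) l i.
Proof.
move=> Fl; elim: s => [|i s IH].
  by under eq_fun do rewrite big_nil; rewrite big_nil; exact: cvg_cst.
by under eq_fun do rewrite big_cons; rewrite big_cons; exact: cvg_absvD.
Qed.

Lemma lim_absv_le u l (b : R) :
  u @ \oo --> l -> (\forall n \near \oo, absv (u n) <= b) -> absv l <= b.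
Proof.
move=> /cvg_absvP/cvgrPdist_lt ul ub; apply/ler_addgt0Pr => e e0.
have [n [un ulb]] := filter_ex (filterI ub (ul e e0)).
rewrite -(subKr (u n) l) absvB_le ?(le_trans un) ?lerDl// ?(ltW e0)//.
move: ulb; rewrite sub0r normrN (ger0_norm (absv_ge0 _)) => /ltW/le_trans; apply.
by rewrite lerDr (le_trans (absv_ge0 (u n)) un).
Qed.

(** In an ultrametric space consecutive terms control all differences, so a
    sequence whose increments tend to zero is already a Cauchy sequence. *)
Lemma ultrametric_cvgn u : complete_space K ->
  (fun n => u n.+1 - u n) @ \oo --> (0 : K) -> cvgn u.
Proof.
move=> Kc /cvg_absvP/cvgrPdist_lt u0; apply: Kc; apply: cauchy_exP => e e0.
have [N _ uN] := u0 e e0.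
exists (u N); exists N => // n /= Nn; rewrite ballEmdist/=.
rewrite -[mdist _ _]/(absv (u N - u n)) absv_distC -(subnKC Nn).
elim: (n - N)%N => [|k IH]; first by rewrite addn0 subrr absv0.
rewrite addnS -(subrK (u (N + k)%N) (u (N + k).+1)) -addrA absvD_lt//.
have := uN (N + k)%N (leq_addr _ _).
by rewrite /= sub0r normrN (ger0_norm (absv_ge0 _)) subr0.
Qed.

Lemma ultrametric_cvg_series u : complete_space K ->
  u @ \oo --> (0 : K) -> cvgn (series u).
Proof.
move=> Kc u0; apply: ultrametric_cvgn => //.
by under eq_fun do rewrite seriesSB.
Qed.

(** The ultrametric inequality bounds every finite block of the series by its
    largest term, and the bound survives in the limit. *)
Lemma series_tail_le u l m (b : R) : 0 <= b -> series u @ \oo --> l ->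
  (forall n, (m <= n)%N -> absv (u n) <= b) -> absv (l - series u m) <= b.
Proof.
move=> b0 ul ub; apply: (@lim_absv_le (fun n => series u n - series u m)).
  by apply: cvg_absvB => //; exact: cvg_cst.
exists m => // n /= mn; rewrite seriesEnat/= (big_cat_nat (leq0n m) mn)//=.
rewrite addrAC subrr add0r.
by apply: absv_sum_nat_le => // i /andP[/ub].
Qed.

End Convergence.

(** * The absolute values of factorials and the radius of convergence *)

Section Factorial.
Variables (p : nat) (p_prime : prime p).

Lemma sum_quotients_lt n m : (0 < n)%N ->
  (p.-1 * \sum_(1 <= k < m.+1) n %/ p ^ k <= n.-1)%N.
Proof.
have p1 := prime_gt1 p_prime.
elim: m n => [|m IH] n n0; first by rewrite big_geq// muln0.
rewrite big_nat_recl// expn1.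
have -> : (\sum_(1 <= i < m.+1) n %/ p ^ i.+1 =
           \sum_(1 <= i < m.+1) (n %/ p) %/ p ^ i)%N.
  by apply: eq_bigr => i _; rewrite expnS divnMA.
have [np0|np0] := posnP (n %/ p).
  by rewrite np0 big1 ?muln0// => i _; rewrite div0n.
have := IH _ np0; set s := (\sum_(_ <= _ < _) _)%N.
have := leq_divM n p; nia.
Qed.

(** Legendre's formula gives (p - 1) v(n!) = n - s(n), where s(n), the sum of
    the base p digits, is at least 1. *)
Lemma logn_fact_lt n : (0 < n)%N -> (p.-1 * logn p n`! <= n.-1)%N.
Proof. by move=> n0; rewrite logn_fact// sum_quotients_lt. Qed.

End Factorial.

Section Radius.
Variables (R : realType) (p : nat) (p_prime : prime p) (C : padic_complex R p).

Lemma absv_natE n : (0 < n)%N -> absv (n%:R : C) = (p%:R ^+ logn p n)^-1.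
Proof.
move=> n0; rewrite -(rmorph_nat (@Qpbar_to_Cp _ _ C)) Cp_absv.
rewrite -(rmorph_nat (@Qp_to_Qpbar _ _ C)) Qpbar_absv.
rewrite -(ratr_nat (Qp C)) Qp_absv /padic_absv.
rewrite pnatr_eq0 (gtn_eqF n0) -[n%:R]/(n%:~R : rat) numq_int denq_int/=.
by rewrite logn1 expr0 mul1r.
Qed.

Lemma natC_neq0 n : (0 < n)%N -> (n%:R : C) != 0.
Proof.
move=> n0; rewrite -absv_eq0 absv_natE// invr_eq0 expf_neq0// pnatr_eq0.
by rewrite -lt0n prime_gt0.
Qed.

Lemma absv_prime_pow N : absv ((p ^ N)%N%:R : C) = p%:R^-1 ^+ N.
Proof. by rewrite absv_natE ?expn_gt0 ?prime_gt0// pfactorK// exprVn. Qed.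

Definition exp_radius : R := p%:R `^ (- (p.-1%:R)^-1).

Let p0 : 0 < p%:R :> R.
Proof. by rewrite ltr0n prime_gt0. Qed.

Let p1 : 1 < p%:R :> R.
Proof. by rewrite ltr1n prime_gt1. Qed.

Lemma radius_gt0 : 0 < exp_radius.
Proof. exact: powR_gt0. Qed.

Lemma radiusX : exp_radius ^+ p.-1 = p%:R^-1.
Proof.
rewrite -powR_mulrn ?(ltW radius_gt0)// -powRrM mulNr mulVf ?powR_inv1 ?(ltW p0)//.
by rewrite pnatr_eq0 -lt0n -subn1 subn_gt0 prime_gt1.
Qed.

Lemma radius_lt1 : exp_radius < 1.
Proof.
rewrite -(@expr_lt1 _ p.-1) ?(ltW radius_gt0)//.
  by rewrite radiusX invf_lt1.
by rewrite -subn1 subn_gt0 prime_gt1.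
Qed.

(** As r^(p-1) = |p|, the bound (p - 1) v(n!) <= n - 1 on the valuation is a
    lower bound for |n!| by a power of r. The exponent n - 1 instead of n makes
    exp z - 1 as small as z, so that exp maps the disc into the disc around 1. *)
Lemma radius_fact n : (0 < n)%N -> exp_radius ^+ n.-1 <= absv (n`!%:R : C).
Proof.
move=> n0; rewrite absv_natE ?fact_gt0// -exprVn -radiusX -exprM.
by rewrite ler_wiXn2l ?(ltW radius_gt0) ?(ltW radius_lt1)// logn_fact_lt.
Qed.

Lemma radius_nat n : (0 < n)%N -> exp_radius ^+ n.-1 <= absv (n%:R : C).
Proof.
case: n => // n _; apply: (le_trans (radius_fact (ltn0Sn n))).
by rewrite factS natrM absvM ler_piMr ?absv_ge0 ?absv_nat_le1.
Qed.

Implicit Types z : C.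

(** The terms of the exponential series at z, and of the logarithmic series at
    1 + z, are dominated by the powers of this number. *)
Definition exp_ratio z : R := absv z / exp_radius.

Lemma ratio_ge0 z : 0 <= exp_ratio z.
Proof. by rewrite divr_ge0 ?absv_ge0 ?(ltW radius_gt0). Qed.

Lemma ratio_lt1 z : absv z < exp_radius -> exp_ratio z < 1.
Proof. by rewrite ltr_pdivrMr ?radius_gt0// mul1r. Qed.

Lemma absv_le_ratio z : absv z <= exp_ratio z.
Proof.
rewrite ler_pdivlMr ?radius_gt0// ler_piMr ?absv_ge0//.
exact: (ltW radius_lt1).
Qed.

Lemma ratioX_cvg0 z : absv z < exp_radius ->
  (fun n => exp_ratio z ^+ n) @ \oo --> (0 : R).
Proof. by move=> zr; apply: cvg_expr; rewrite ger0_norm ?ratio_ge0 ?ratio_lt1. Qed.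

Lemma absv_div_le z (d : C) n : 0 < absv d -> exp_radius ^+ n <= absv d ->
  absv (z ^+ n.+1 / d) <= absv z * exp_ratio z ^+ n.
Proof.
move=> d0 rd; rewrite absvM absvX absvV exprS -mulrA ler_wpM2l ?absv_ge0//.
rewrite /exp_ratio expr_div_n ler_wpM2l ?exprn_ge0 ?absv_ge0//.
by rewrite lef_pV2// posrE exprn_gt0 ?radius_gt0.
Qed.

Lemma absv_exp_term z n : absv (z ^+ n.+1 / n.+1`!%:R) <= absv z * exp_ratio z ^+ n.
Proof.
apply: absv_div_le; last exact: (@radius_fact n.+1).
by rewrite absv_gt0 natC_neq0 ?fact_gt0.
Qed.

Lemma absv_log_term z n : absv (z ^+ n.+1 / n.+1%:R) <= absv z * exp_ratio z ^+ n.
Proof.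
apply: absv_div_le; last exact: (@radius_nat n.+1).
by rewrite absv_gt0 natC_neq0.
Qed.

Lemma absv_exp_term_ratio z n : absv (z ^+ n / n`!%:R) <= exp_ratio z ^+ n.
Proof.
case: n => [|n]; first by rewrite !expr0 fact0 divr1 absv1.
rewrite (le_trans (absv_exp_term z n))// exprS.
by rewrite ler_wpM2r ?exprn_ge0 ?ratio_ge0 ?absv_le_ratio.
Qed.

End Radius.

(** * The exponential series *)

(** Both sides list the pairs (i, j) with i + j < n. *)
Lemma sum_antidiagonals (V : nmodType) (F : nat -> nat -> V) n :
  \sum_(0 <= m < n) \sum_(0 <= i < m.+1) F i (m - i)%N =
  \sum_(0 <= i < n) \sum_(0 <= j < n - i) F i j.
Proof.
elim: n => [|n IH]; first by rewrite !big_geq.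
rewrite big_nat_recr//= IH.
have -> : \sum_(0 <= i < n.+1) \sum_(0 <= j < n.+1 - i) F i j =
    \sum_(0 <= i < n.+1) (\sum_(0 <= j < n - i) F i j + F i (n - i)%N).
  apply: eq_big_nat => i /andP[_ iN].
  by rewrite subSn// big_nat_recr.
rewrite big_split/=; congr (_ + _).
by rewrite big_nat_recr//= subnn [X in _ + X]big_geq// addr0.
Qed.

Section Exponential.
Variables (R : realType) (p : nat) (p_prime : prime p) (C : padic_complex R p).
Implicit Types z : C.

Lemma cvg_pexp z : absv z < exp_radius R p ->
  series (fun n => z ^+ n / n`!%:R) @ \oo --> pexp z.
Proof.
move=> zr; apply: ultrametric_cvg_series; first exact: Cp_complete.
apply: cvg_absv_le (ratioX_cvg0 p_prime zr) => n.
by rewrite subr0; exact: absv_exp_term_ratio.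
Qed.

Lemma pexp0 : pexp (0 : C) = 1.
Proof.
have z0 : absv (0 : C) < exp_radius R p by rewrite absv0 radius_gt0.
apply/eqP; rewrite -subr_eq0 -absv_eq0 eq_le absv_ge0 andbT.
have -> : (1 : C) = series (fun n => (0 : C) ^+ n / n`!%:R) 1.
  by rewrite seriesEnat/= big_nat1 expr0 fact0 divr1.
apply: (series_tail_le _ (cvg_pexp z0)) => // -[//|n _].
by rewrite expr0n mul0r absv0.
Qed.

Let exp_remainder z m : absv z < exp_radius R p ->
  absv (pexp z - series (fun n => z ^+ n / n`!%:R) m.+1) <= absv z * exp_ratio z ^+ m.
Proof.
move=> zr; apply: (series_tail_le _ (cvg_pexp zr)).
  by rewrite mulr_ge0 ?exprn_ge0 ?ratio_ge0 ?absv_ge0.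
case=> // n mn; rewrite (le_trans (absv_exp_term p_prime z n))//.
rewrite ler_wpM2l ?absv_ge0// ler_wiXn2l ?ratio_ge0//.
exact/ltW/ratio_lt1.
Qed.

Lemma absv_pexp_sub1 z : absv z < exp_radius R p -> absv (pexp z - 1) <= absv z.
Proof.
move=> /(exp_remainder 0).
by rewrite expr0 mulr1 seriesEnat/= big_nat1 expr0 fact0 divr1.
Qed.

Lemma absv_pexp_linear z : absv z < exp_radius R p ->
  absv (pexp z - (1 + z)) <= absv z * exp_ratio z.
Proof.
move=> /(exp_remainder 1).
by rewrite expr1 seriesEnat/= big_nat_recr//= big_nat1 expr0 fact0 expr1 !divr1.
Qed.

(** The product of the partial sums of order n differs from the partial sum for
    [z + w] by the terms with i, j < n <= i + j, which are uniformly small. *)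
Lemma pexpD z w : absv z < exp_radius R p -> absv w < exp_radius R p ->
  pexp (z + w) = pexp z * pexp w.
Proof.
wlog zw : z w / absv z <= absv w.
  move=> H zr wr; case: (leP (absv z) (absv w)) => [|/ltW] zw; first exact: H.
  by rewrite addrC mulrC; exact: H.
move=> zr wr; have zwr := absvD_lt zr wr.
pose e (x : C) n := x ^+ n / n`!%:R.
have small : (fun n => series (e (z + w)) n - series (e z) n * series (e w) n)
    @ \oo --> (0 : C).
  apply: cvg_absv_le (ratioX_cvg0 p_prime wr) => n; rewrite subr0 !seriesEnat/=.
  have -> : \sum_(0 <= m < n) e (z + w) m =
      \sum_(0 <= i < n) \sum_(0 <= j < n - i) e z i * e w j.
    rewrite -(sum_antidiagonals (fun i j => e z i * e w j)).
    apply: eq_bigr => m _; rewrite /e addrC exprDn mulr_suml big_mkord.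
    apply: eq_bigr => -[i /=]; rewrite ltnS => im _.
    have := bin_fact im; move/(congr1 (fun n => n%:R : C)); rewrite !natrM => <-.
    rewrite -mulr_natr; field.
    by rewrite !natC_neq0 ?fact_gt0 ?bin_gt0.
  rewrite mulr_suml -sumrB; apply: absv_sum_nat_le => [|i /andP[_ iN]].
    by rewrite exprn_ge0 ?ratio_ge0.
  rewrite mulr_sumr (big_cat_nat (leq0n _) (leq_subr i n))//= opprD addrA subrr sub0r.
  rewrite absvN; apply: absv_sum_nat_le => [|j /andP[nij _]].
    by rewrite exprn_ge0 ?ratio_ge0.
  rewrite absvM (@le_trans _ _ (exp_ratio w ^+ i * exp_ratio w ^+ j))//.
    rewrite ler_pM ?absv_ge0 ?absv_exp_term_ratio//.
    rewrite (le_trans (absv_exp_term_ratio p_prime z i))// lerXn2r ?nnegrE ?ratio_ge0//.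
    by rewrite ler_wpM2r// invr_ge0 ltW ?radius_gt0.
  rewrite -exprD ler_wiXn2l ?ratio_ge0 ?(ltW (ratio_lt1 _ _))//.
  by rewrite -leq_subLR.
apply/eqP; rewrite -subr_eq0 -(limnE small); apply/eqP/esym/limnE.
by apply: cvg_absvB; [|apply: cvg_absvM]; exact: cvg_pexp.
Qed.

Lemma absv_natM_lt n z : absv z < exp_radius R p -> absv (n%:R * z) < exp_radius R p.
Proof. by apply: le_lt_trans; rewrite absvM_le ?absv_nat_le1. Qed.

Lemma pexp_natM n z : absv z < exp_radius R p -> pexp (n%:R * z) = pexp z ^+ n.
Proof.
move=> zr; elim: n => [|n IH]; first by rewrite mul0r pexp0.
by rewrite -natr1 mulrDl mul1r pexpD ?absv_natM_lt// IH exprSr.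
Qed.

End Exponential.

(** * The logarithm as inverse of the exponential *)

Section Logarithm.
Variables (R : realType) (p : nat) (p_prime : prime p) (C : padic_complex R p).
Implicit Types q : C.

Lemma expr_sub1 q M : q ^+ M - 1 =
  M%:R * \sum_(0 <= j < M) 'C(M.-1, j)%:R * ((q - 1) ^+ j.+1 / j.+1%:R).
Proof.
rewrite -[in LHS](subrK 1 q) addrC -[X in X ^+ M]addrC exprDn.
rewrite big_ord_recl/= !expr1n expr0 mulr1 bin0 mulr1n addrA addNr add0r.
rewrite mulr_sumr big_mkord; apply: eq_bigr => -[j jM] _ /=.
rewrite /bump/= add1n expr1n mul1r mulrA -natrM mul_bin_diag natrM -mulr_natr.
by field; rewrite -[1]/1%:R -natrD natC_neq0.
Qed.

Section Disc.
Variables (q : C) (hq : absv (1 - q) < exp_radius R p).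

Let hq' : absv (q - 1) < exp_radius R p.
Proof. by rewrite absv_distC. Qed.

Lemma absv_disc : absv q = 1.
Proof. exact/absv_unit/(lt_trans hq)/radius_lt1. Qed.

Lemma disc_neq0 : q != 0.
Proof. by rewrite -absv_eq0 absv_disc oner_eq0. Qed.

(** In q^M - 1 = M (t + sum of C(M-1, j) t^(j+1) / (j+1) over j > 0), where
    t = q - 1, the term t dominates the sum. *)
Lemma absv_expr_sub1 M : absv (q ^+ M - 1) = absv (M%:R : C) * absv (q - 1).
Proof.
case: M => [|M]; first by rewrite expr0 subrr !absv0 mul0r.
rewrite expr_sub1 absvM; congr (_ * _).
have [->|q1] := eqVneq q 1.
  by rewrite subrr big1// => j _; rewrite expr0n mul0r mulr0.
rewrite big_nat_recl//= bin0 mul1r expr1 divr1 [LHS]absvD_dominant//.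
have q1_gt0 : 0 < absv (q - 1) by rewrite absv_gt0 subr_eq0.
apply: (@le_lt_trans _ _ (absv (q - 1) * exp_ratio (q - 1))); last first.
  by rewrite gtr_pMr ?ratio_lt1.
apply: absv_sum_nat_le => [|j _]; first by rewrite mulr_ge0 ?ratio_ge0 ?absv_ge0.
rewrite absvM_le ?absv_nat_le1// (le_trans (absv_log_term p_prime _ _))//.
rewrite ler_wpM2l ?absv_ge0// -[leRHS]expr1 ler_wiXn2l ?ratio_ge0//.
exact/ltW/ratio_lt1.
Qed.

Let log_term_le n m : (m <= n)%N ->
  absv ((-1) ^+ n * (q - 1) ^+ n.+1 / n.+1%:R) <= absv (q - 1) * exp_ratio (q - 1) ^+ m.
Proof.
move=> mn; rewrite -mulrA absvM absv_sign mul1r.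
rewrite (le_trans (absv_log_term p_prime _ _))// ler_wpM2l ?absv_ge0//.
by rewrite ler_wiXn2l ?ratio_ge0//; exact/ltW/ratio_lt1.
Qed.

Lemma cvg_plog :
  series (fun n => (-1) ^+ n * (q - 1) ^+ n.+1 / n.+1%:R) @ \oo --> plog q.
Proof.
apply: ultrametric_cvg_series; first exact: Cp_complete.
apply: cvg_absv_le (ratioX_cvg0 p_prime hq') => n.
rewrite subr0 (le_trans (log_term_le (leqnn n)))//.
rewrite ler_piMl ?exprn_ge0 ?ratio_ge0//.
by rewrite (ltW (lt_trans hq' (radius_lt1 _ _))).
Qed.

Lemma absv_plog : absv (plog q) < exp_radius R p.
Proof.
have := series_tail_le (m := 0) (absv_ge0 (q - 1)) cvg_plog.
rewrite seriesEnat/= big_geq// subr0 => l_le.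
apply: le_lt_trans hq'; apply: l_le => n _.
by rewrite (le_trans (log_term_le (leq0n n)))// expr0 mulr1.
Qed.

(** Pascal's rule reads C(M-1, j+1) + C(M-1, j) = C(M, j+1) = M C(M-1, j) / (j+1),
    so C(M-1, j) is close to (-1)^j when |M| is small. *)
Lemma absv_bin_sign M j : (0 < M)%N ->
  absv ('C(M.-1, j)%:R - (-1) ^+ j : C) <= absv (M%:R : C) / exp_radius R p ^+ j.
Proof.
case: M => // M _ /=; have r0 := radius_gt0 R p_prime.
have r_le1 := ltW (radius_lt1 R p_prime).
elim: j => [|j IH].
  by rewrite bin0 subrr absv0 divr_ge0 ?absv_ge0 ?exprn_ge0 ?(ltW r0).
have le_r : absv (M.+1%:R : C) / exp_radius R p ^+ j <=
    absv (M.+1%:R : C) / exp_radius R p ^+ j.+1.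
  rewrite ler_wpM2l ?absv_ge0// lef_pV2 ?posrE ?exprn_gt0//.
  by rewrite ler_wiXn2l ?(ltW r0).
have -> : 'C(M, j.+1)%:R - (-1) ^+ j.+1 =
    M.+1%:R * 'C(M, j)%:R / j.+1%:R - ('C(M, j)%:R - (-1) ^+ j) :> C.
  rewrite -natrM (mul_bin_diag M.+1) natrM [_%:R * _]mulrC mulfK ?natC_neq0//.
  by rewrite binS natrD exprS; ring.
apply: absvB_le; last exact: le_trans IH le_r.
rewrite (le_trans _ le_r)// -mulrA absvM ler_wpM2l ?absv_ge0//.
apply: absvM_le; first exact: absv_nat_le1.
rewrite absvV lef_pV2 ?posrE ?exprn_gt0 ?absv_gt0 ?natC_neq0//.
exact: (radius_nat p_prime C (ltn0Sn j)).
Qed.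

(** For M = p^N the binomial coefficients C(M-1, j) with j <= N are close to
    (-1)^j, and the terms with j > N are small in both sums. *)
Lemma absv_expr_sub1_plog N : odd p ->
  absv (q ^+ (p ^ N) - 1 - (p ^ N)%N%:R * plog q) <=
  absv ((p ^ N)%N%:R : C) * (exp_radius R p ^+ N + exp_ratio (q - 1) ^+ N).
Proof.
move=> p_odd; set M := (p ^ N)%N.
have r0 := radius_gt0 R p_prime; have r_le1 := ltW (radius_lt1 R p_prime).
have M0 : (0 < M)%N by rewrite expn_gt0 prime_gt0.
have t0 := ratio_ge0 p_prime (q - 1); have t1 := ratio_lt1 p_prime hq'.
have q1_le1 : absv (q - 1) <= 1 by rewrite (ltW (lt_trans hq' (radius_lt1 _ _))).
have b0 : 0 <= exp_radius R p ^+ N + exp_ratio (q - 1) ^+ N.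
  by rewrite addr_ge0 ?exprn_ge0 ?(ltW r0).
rewrite expr_sub1 -mulrBr absvM ler_wpM2l ?absv_ge0//.
set a := fun n => (-1) ^+ n * (q - 1) ^+ n.+1 / n.+1%:R.
rewrite -[X in absv (X - _)](subrK (series a M)) -addrA absvD_le//; last first.
  rewrite absv_distC.
  apply: (series_tail_le _ cvg_plog) => // n Mn.
  have Nn : (N <= n)%N by rewrite (leq_trans _ Mn)// ltnW// ltn_expl ?prime_gt1.
  rewrite (le_trans (log_term_le Nn))// -[leLHS]add0r lerD ?exprn_ge0 ?(ltW r0)//.
  by rewrite ler_piMl ?exprn_ge0.
rewrite seriesEnat/= -sumrB; apply: absv_sum_nat_le => // j _.
have -> : 'C(M.-1, j)%:R * ((q - 1) ^+ j.+1 / j.+1%:R) - a j =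
    ('C(M.-1, j)%:R - (-1) ^+ j) * ((q - 1) ^+ j.+1 / j.+1%:R).
  by rewrite /a; ring.
have term_le1 k : (k <= j)%N ->
    absv ((q - 1) ^+ j.+1 / j.+1%:R) <= exp_ratio (q - 1) ^+ k.
  move=> kj; rewrite (le_trans (absv_log_term p_prime _ _))//.
  rewrite (@le_trans _ _ (exp_ratio (q - 1) ^+ j)) ?ler_piMl ?exprn_ge0//.
  by rewrite ler_wiXn2l// ltW.
have [jN|/ltnW Nj] := leqP j N.
  rewrite -[leRHS]mulr1 absvM ler_pM ?absv_ge0//; last first.
    by rewrite (le_trans (term_le1 0%N _)).
  rewrite -[leLHS]addr0 lerD ?exprn_ge0//.
  rewrite (le_trans (absv_bin_sign _ M0))// ler_pdivrMr ?exprn_gt0// -exprD.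
  rewrite absv_prime_pow// -(radiusX R p_prime) -exprM ler_wiXn2l ?(ltW r0)//.
  (* |M| = r^((p-1)N) makes up for the denominator r^j, as p - 1 >= 2 and j <= N *)
  have p2 : (2 <= p.-1)%N.
    by move: p_odd (prime_gt1 p_prime); case: (p) => [|[|[|[]]]].
  by rewrite (leq_trans (leq_add (leqnn N) jN))// addnn -mul2n leq_mul2r p2 orbT.
rewrite absvM_le//; first by rewrite absvB_le ?absv_nat_le1 ?absv_sign.
by rewrite (le_trans (term_le1 _ Nj))// lerDr exprn_ge0// ltW.
Qed.

End Disc.

(** Put E = exp (log q) and M = p^N. Both E^M and q^M are 1 + M log q up to an
    error that is small compared with |M|, while (E / q)^M - 1 has exactly the
    size of M (E / q - 1). Hence |E - q| tends to 0 as N grows. *)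
Lemma pexp_plog q : odd p -> absv (1 - q) < exp_radius R p -> pexp (plog q) = q.
Proof.
move=> p_odd hq; set E := pexp (plog q).
have lr := absv_plog hq; have q0 := disc_neq0 hq.
have t0 := ratio_ge0 p_prime (q - 1).
have r0 := radius_gt0 R p_prime; have r_le1 := ltW (radius_lt1 R p_prime).
have Er : absv (1 - E) < exp_radius R p.
  by rewrite absv_distC (le_lt_trans (absv_pexp_sub1 p_prime lr)).
have Eqr : absv (E / q - 1) = absv (E - q).
  by rewrite -[1](divff q0) -mulrBl absvM absvV (absv_disc hq) invr1 mulr1.
have ur : absv (1 - E / q) < exp_radius R p.
  rewrite absv_distC Eqr -(subrK 1 E) -addrA absvD_lt//.
  by rewrite absv_distC.
suff : (fun=> E) @ \oo --> q by move=> /limnE <-; apply/esym/limnE; exact: cvg_cst.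
apply: (@cvg_absv_le _ _ _ _ (fun N => exp_radius R p ^+ N + exp_ratio (q - 1) ^+ N));
  last first.
  rewrite -[0]addr0; apply: cvgD.
  2: by apply: ratioX_cvg0 => //; rewrite absv_distC.
  by apply: cvg_expr; rewrite (ger0_norm (ltW r0)) radius_lt1.
move=> N; set M := (p ^ N)%N.
have M0 : 0 < absv (M%:R : C).
  by rewrite absv_gt0 natC_neq0// expn_gt0 prime_gt0.
rewrite -(ler_pM2l M0) -Eqr.
have -> : absv (M%:R : C) * absv (E / q - 1) = absv (E ^+ M - q ^+ M).
  rewrite -(absv_expr_sub1 ur) -[LHS]mulr1.
  have <- : absv (q ^+ M) = 1 by rewrite absvX (absv_disc hq) expr1n.
  by rewrite -absvM mulrBl mul1r expr_div_n divfK// expf_neq0.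
rewrite -(subrK (1 + M%:R * plog q) (E ^+ M)) -addrA absvD_le//; last first.
  by rewrite absv_distC opprD addrA; exact: absv_expr_sub1_plog.
have Mlr := absv_natM_lt M lr.
rewrite -pexp_natM// (le_trans (absv_pexp_linear p_prime Mlr))//.
have Mr : absv (M%:R : C) <= exp_radius R p ^+ N.
  rewrite absv_prime_pow// -(radiusX R p_prime) -exprM ler_wiXn2l ?(ltW r0)//.
  by rewrite leq_pmull// -subn1 subn_gt0 prime_gt1.
rewrite {1}/exp_ratio absvM -!mulrA ler_wpM2l ?absv_ge0//.
rewrite mulrCA -[leRHS]mulr1 ler_pM ?mulr_ge0 ?invr_ge0 ?absv_ge0 ?(ltW r0)//.
  by rewrite (le_trans Mr)// lerDl exprn_ge0.
rewrite mulr_ile1 ?divr_ge0 ?absv_ge0 ?(ltW r0)//.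
  exact/ltW/(lt_trans lr)/radius_lt1.
exact/ltW/ratio_lt1.
Qed.

End Logarithm.

(** * Powers and brackets at integers *)

(** The bracket of a natural number as a polynomial in [q], which avoids the
    case distinction at [q = 1]. *)
Definition qint (F : fieldType) (q : F) n : F := \sum_(0 <= i < n) q ^+ i.

Section Bracket.
Variables (F : fieldType) (q : F).

Lemma qint0 : qint q 0 = 0.
Proof. by rewrite /qint big_geq. Qed.

Lemma qint1 : qint q 1 = 1.
Proof. by rewrite /qint big_nat1. Qed.

Lemma qintS n : qint q n.+1 = qint q n + q ^+ n.
Proof. by rewrite /qint big_nat_recr. Qed.

Lemma qintD m n : qint q (m + n) = qint q m + q ^+ m * qint q n.
Proof.
elim: n => [|n IH]; first by rewrite addn0 qint0 mulr0 addr0.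
by rewrite addnS !qintS IH exprD mulrDr addrA.
Qed.

Lemma qint_sub1 n : (q - 1) * qint q n = q ^+ n - 1.
Proof. by rewrite subrX1 /qint big_mkord. Qed.

End Bracket.

Lemma qintV (F : fieldType) (q : F) n : q != 0 -> q ^+ n * qint q^-1 n.+1 = qint q n.+1.
Proof.
move=> q0; elim: n => [|n IH]; first by rewrite !qint1 expr0 mul1r.
rewrite qintS mulrDr exprS -mulrA IH -exprS exprVn divff ?expf_neq0//.
by rewrite -[n.+2]add1n qintD expr1 qint1 addrC.
Qed.

Section Disc.
Variables (R : realType) (p : nat) (p_prime : prime p) (p_odd : odd p).
Variables (C : padic_complex R p).
Implicit Types q : C.

Lemma disc_inv q : absv (1 - q) < exp_radius R p -> absv (1 - q^-1) < exp_radius R p.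
Proof.
move=> hq; have q0 := disc_neq0 p_prime hq.
rewrite -[X in absv (X - _)](divff q0) -[X in absv (_ - X)]mul1r -mulrBl absvM.
by rewrite absvV (absv_disc p_prime hq) invr1 mulr1 absv_distC.
Qed.

Section Powers.
Variables (q : C) (hq : absv (1 - q) < exp_radius R p).

Lemma qpow_nat n : qpow q n%:R = q ^+ n.
Proof. by rewrite /qpow pexp_natM ?pexp_plog// absv_plog. Qed.

Lemma qpow_1B n : qpow q (1 - n%:R) = q / q ^+ n.
Proof.
have qn0 : q ^+ n != 0 by rewrite expf_neq0// (disc_neq0 p_prime hq).
have lr := absv_plog p_prime hq; apply: (mulIf qn0).
rewrite divfK// -qpow_nat /qpow -pexpD ?absv_natM_lt//.
  by rewrite -mulrDl subrK mul1r pexp_plog.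
by apply: le_lt_trans lr; rewrite absvM_le// absvB_le ?absv1 ?absv_nat_le1.
Qed.

Lemma qnum_nat n : qnum q n%:R = qint q n.
Proof.
rewrite /qnum; case: eqP => [->|/eqP q1].
  rewrite /qint; under eq_bigr do rewrite expr1n.
  by rewrite sumr_const_nat subn0.
rewrite qpow_nat; apply: (@mulfI _ (1 - q)); first by rewrite subr_eq0 eq_sym.
rewrite mulrCA divff ?mulr1 ?subr_eq0 1?eq_sym//.
by rewrite -(opprB q) mulNr qint_sub1 opprB.
Qed.

Lemma absv_qpow n : absv (q ^+ n) = 1.
Proof. by rewrite absvX (absv_disc p_prime hq) expr1n. Qed.

Lemma absv_qint_le1 n : absv (qint q n) <= 1.
Proof. by apply: absv_sum_nat_le => // i _; rewrite absv_qpow. Qed.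

Lemma absv_qint n : absv (qint q n) = absv (n%:R : C).
Proof.
have [->|q1] := eqVneq q 1.
  rewrite /qint; under eq_bigr do rewrite expr1n.
  by rewrite sumr_const_nat subn0.
have q1' : absv (q - 1) != 0 by rewrite absv_eq0 subr_eq0.
by apply: (mulfI q1'); rewrite -absvM qint_sub1 (absv_expr_sub1 p_prime hq) mulrC.
Qed.

Lemma absv_expr_sub1_le n : absv (q ^+ n - 1) <= absv (n%:R : C).
Proof.
rewrite (absv_expr_sub1 p_prime hq) ler_piMr ?absv_ge0// absv_distC.
exact/ltW/(lt_trans hq)/radius_lt1.
Qed.

End Powers.

(** For q <> 1 both sides are (q - q^n) / (q - 1). *)
Lemma qnum_1B q n : absv (1 - q) < exp_radius R p ->
  qnum q^-1 (1 - n%:R) = 1 - qint q n.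
Proof.
move=> hq; have q0 := disc_neq0 p_prime hq.
rewrite /qnum invr_eq1; case: eqP => [->|/eqP q1].
  rewrite /qint; under eq_bigr do rewrite expr1n.
  by rewrite sumr_const_nat subn0.
rewrite qpow_1B ?disc_inv// exprVn invrK.
have qV1 : 1 - q^-1 != 0 by rewrite subr_eq0 eq_sym invr_eq1.
apply: (mulIf qV1); rewrite divfK//; apply: (mulfI q0).
have -> : q * ((1 - qint q n) * (1 - q^-1)) = (q - 1) - (q - 1) * qint q n.
  by field.
by rewrite qint_sub1; field.
Qed.

(** * Lipschitz functions and alternating sums *)

(** The Lipschitz condition with constant 1 for the p-adic distance: increments
    by p^N suffice, as the ultrametric inequality extends the estimate to all
    multiples of p^N. The bound 1 on the values makes the class stable under
    products. *)
Definition padic_lipschitz (g : nat -> C) :=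
  (forall x, absv (g x) <= 1) /\
  (forall x N, absv (g (x + p ^ N)%N - g x) <= absv ((p ^ N)%N%:R : C)).

Lemma absv_mulB_le (a b c d : C) (e : R) : absv a <= 1 -> absv d <= 1 ->
  absv (a - c) <= e -> absv (b - d) <= e -> absv (a * b - c * d) <= e.
Proof.
move=> a1 d1 ac bd; have -> : a * b - c * d = a * (b - d) + d * (a - c) by ring.
by rewrite absvD_le// absvM_le.
Qed.

Lemma absv_exprB_le (a b : C) m (e : R) : 0 <= e -> absv a <= 1 -> absv b <= 1 ->
  absv (a - b) <= e -> absv (a ^+ m - b ^+ m) <= e.
Proof.
move=> e0 a1 b1 ab; elim: m => [|m IH]; first by rewrite !expr0 subrr absv0.
by rewrite !exprS absv_mulB_le// absvX_le1.
Qed.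

Lemma padic_lipschitzM g1 g2 : padic_lipschitz g1 -> padic_lipschitz g2 ->
  padic_lipschitz (fun x => g1 x * g2 x).
Proof.
move=> [b1 l1] [b2 l2]; split=> [x|x N]; first by rewrite absvM_le1.
by rewrite absv_mulB_le.
Qed.

Lemma padic_lipschitzX g m : padic_lipschitz g ->
  padic_lipschitz (fun x => g x ^+ m).
Proof.
move=> [b l]; split=> [x|x N]; first by rewrite absvX_le1.
by rewrite absv_exprB_le ?absv_ge0.
Qed.

Lemma padic_lipschitz_pow q : absv (1 - q) < exp_radius R p ->
  padic_lipschitz (fun x => q ^+ x).
Proof.
move=> hq; split=> [x|x N]; first by rewrite absv_qpow.
rewrite exprD -[X in _ - X]mulr1 -mulrBr absvM absv_qpow// mul1r.
exact: absv_expr_sub1_le.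
Qed.

Lemma padic_lipschitz_qint q : absv (1 - q) < exp_radius R p ->
  padic_lipschitz (qint q).
Proof.
move=> hq; split=> [x|x N]; first by rewrite absv_qint_le1.
by rewrite qintD addrAC subrr add0r absvM absv_qpow// mul1r absv_qint.
Qed.

Lemma padic_lipschitz_shift g : padic_lipschitz g -> padic_lipschitz (g \o succn).
Proof. by move=> [b l]; split=> [x|x N] /=; rewrite -?addSn. Qed.

Lemma absv_lipschitz_mul g x j N : padic_lipschitz g ->
  absv (g (j * p ^ N + x)%N - g x) <= absv ((p ^ N)%N%:R : C).
Proof.
move=> [_ l]; elim: j => [|j IH]; first by rewrite mul0n subrr absv0 absv_ge0.
rewrite mulSn -addnA addnC -(subrK (g (j * p ^ N + x)%N) (g _)) -addrA.
by rewrite absvD_le.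
Qed.

Definition altsum (g : nat -> C) (N : nat) : C :=
  \sum_(0 <= x < p ^ N) (-1) ^+ x * g x.

Let odd_pX N : odd (p ^ N).
Proof. by rewrite oddX p_odd orbT. Qed.

Lemma absv_ppow_cvg0 : (fun N => absv ((p ^ N)%N%:R : C)) @ \oo --> (0 : R).
Proof.
under eq_fun do rewrite absv_prime_pow//.
apply: cvg_expr; rewrite ger0_norm ?invr_ge0 ?ler0n// invf_lt1 ?ltr1n ?prime_gt1//.
by rewrite ltr0n prime_gt0.
Qed.

(** The p blocks of length p^N in the sum of length p^(N+1) almost agree up to
    alternating signs, and [1 - 1 + ... + 1 = 1] as p is odd. *)
Lemma cvg_altsum g : padic_lipschitz g -> cvgn (altsum g).
Proof.
move=> gl; apply: ultrametric_cvgn; first exact: Cp_complete.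
apply: cvg_absv_le absv_ppow_cvg0 => N; rewrite subr0.
set M := (p ^ N)%N.
have alt1 k : odd k -> \sum_(0 <= j < k) (-1) ^+ j = 1 :> C.
  move=> k_odd; rewrite -(odd_double_half k) k_odd add1n.
  elim: (k./2) => [|i IH]; first by rewrite big_nat1.
  rewrite doubleS big_nat_recr//= big_nat_recr//= IH.
  by rewrite [in X in _ + X]exprS mulN1r addrK.
have -> : altsum g N = \sum_(0 <= j < p) (-1) ^+ j * altsum g N.
  by rewrite -mulr_suml alt1 ?mul1r.
rewrite /altsum expnS big_nat_mul -sumrB.
apply: absv_sum_nat_le => [|j _]; first exact: absv_ge0.
rewrite -/M -{1}[(j * M)%N]add0n big_addn mulSn addnK mulr_sumr -sumrB.
apply: absv_sum_nat_le => [|x _]; first exact: absv_ge0.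
have -> : (-1) ^+ (x + j * M) * g (x + j * M)%N - (-1) ^+ j * ((-1) ^+ x * g x) =
    (-1) ^+ (x + j) * (g (j * M + x)%N - g x).
  have -> : (-1) ^+ (x + j * M) = (-1) ^+ (x + j) :> C.
    by rewrite -signr_odd oddD oddM odd_pX andbT -oddD signr_odd.
  by rewrite exprD [(j * M + x)%N]addnC; ring.
by rewrite absvM absv_sign mul1r absv_lipschitz_mul.
Qed.

(** Shifting the argument of an alternating sum changes its sign, up to the
    boundary terms g(0) and g(p^N), which coalesce in the limit. *)
Lemma cvg_altsum_shift g s : padic_lipschitz g -> altsum g @ \oo --> s ->
  altsum (g \o succn) @ \oo --> 2 * g 0%N - s.
Proof.
move=> [_ gl] gs.
have -> : altsum (g \o succn) =
    (fun N => 2 * g 0%N + (g (0 + p ^ N)%N - g 0%N) - altsum g N).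
  apply/funext => N; rewrite /altsum.
  have := odd_pX N; have : (0 < p ^ N)%N by rewrite expn_gt0 prime_gt0.
  case: (p ^ N)%N => // M _ /= M_even.
  rewrite [in RHS]big_nat_recl// big_nat_recr//= expr0 mul1r add0n.
  rewrite -[(-1) ^+ M]signr_odd (negbTE M_even) expr0 mul1r.
  under [X in _ = _ - (_ + X)]eq_bigr do rewrite exprS -mulrA mulN1r.
  by rewrite sumrN; ring.
apply: cvg_absvB => //; rewrite -[X in _ --> X]addr0; apply: cvg_absvD.
  exact: cvg_cst.
by apply: cvg_absv_le absv_ppow_cvg0 => N; rewrite subr0.
Qed.

(** The reflection [x |-> p^N - 1 - x] preserves the signs since p^N is odd. *)
Lemma altsum_rev g N :
  altsum g N = \sum_(0 <= y < p ^ N) (-1) ^+ y * g (p ^ N - y.+1)%N.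
Proof.
rewrite /altsum big_nat_rev/= add0n; apply: eq_big_nat => y /andP[_ yM].
by congr (_ * _); rewrite -signr_odd oddB// odd_pX addTb /= negbK signr_odd.
Qed.

End Disc.

(** * The fermionic integral and its reflection formula *)

Section Integral.
Variables (R : realType) (p : nat) (p_prime : prime p) (p_odd : odd p).
Variables (C : padic_complex R p).

Lemma absv2 : absv (2 : C) = 1.
Proof.
rewrite absv_natE// logn_coprime ?expr0 ?invr1//.
by rewrite prime_coprime// gtnNdvd//; case: (p) p_odd (prime_gt1 p_prime) => [|[|[|]]].
Qed.

Section Moments.
Variables (q : C) (hq : absv (1 - q) < exp_radius R p).

Lemma absv_1Dexpr n : absv (1 + q ^+ n) = 1.
Proof.
have -> : 1 + q ^+ n = 2 + (q ^+ n - 1) by ring.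
rewrite absvD_dominant absv2// (absv_expr_sub1 p_prime hq).
rewrite (@le_lt_trans _ _ (absv (q - 1)))//.
  by rewrite ler_piMl ?absv_ge0 ?absv_nat_le1.
by rewrite absv_distC (lt_trans hq)// radius_lt1.
Qed.

(** As p^N is odd, [p^N]_{-q} = (1 + q^(p^N)) / (1 + q), which tends to
    2 / (1 + q). *)
Lemma cvg_qnumNV :
  (fun N => (qnumN q (p ^ N))^-1) @ \oo --> (1 + q) / 2.
Proof.
apply: cvg_absv_le (absv_ppow_cvg0 p_prime C) => N.
have q1 : 1 + q != 0.
  by rewrite -absv_eq0 -[q in 1 + q]expr1 absv_1Dexpr oner_eq0.
have qM : 1 + q ^+ (p ^ N) != 0 by rewrite -absv_eq0 absv_1Dexpr oner_eq0.
have two0 : (2 : C) != 0 by rewrite -absv_eq0 absv2 oner_eq0.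
have -> : (qnumN q (p ^ N))^-1 - (1 + q) / 2 =
    - ((1 + q ^+ 1) / (2 * (1 + q ^+ (p ^ N))) * (q ^+ (p ^ N) - 1)).
  rewrite /qnumN exprNn -signr_odd oddX p_odd orbT /= !expr1 mulN1r opprK.
  by field; rewrite qM q1 two0.
rewrite absvN 2!absvM absvV absvM !absv_1Dexpr absv2 !mul1r invr1 mul1r.
exact: absv_expr_sub1_le.
Qed.

Lemma fermionic_intE (f : C -> C) (g : nat -> C) (s : C) :
  (forall x, f x%:R * q ^+ x = g x) -> altsum g @ \oo --> s ->
  fermionic_int q f = (1 + q) / 2 * s.
Proof.
move=> fg gs; rewrite /fermionic_int; apply: limnE.
under eq_fun do under eq_bigr do rewrite -mulrA fg.
exact: cvg_absvM cvg_qnumNV gs.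
Qed.

End Moments.

Section Reflection.
Variables (q : C) (hq : absv (1 - q) < exp_radius R p).

Let hqV : absv (1 - q^-1) < exp_radius R p.
Proof. exact: disc_inv. Qed.

Let q0 : q != 0.
Proof. exact: (disc_neq0 p_prime hq). Qed.

(** The reflection [y = p^N - 1 - x] turns [q^x] into [q^-(y+1)] and
    [1 - [x]_q] into [y + 2]_{1/q}, up to errors bounded by [|p^N|], because
    [q^(p^N) - 1] and [[p^N]_q] are that small. *)
Lemma cvg_altsum_reflect h m (s : C) :
  altsum (fun y => q^-1 ^+ y.+1 ^+ h * qint q^-1 y.+2 ^+ m) @ \oo --> s ->
  altsum (fun x => q ^+ x ^+ h * (1 - qint q x) ^+ m) @ \oo --> s.
Proof.
move=> ys; set u := altsum _.
have -> : u = (fun N => altsum (fun y => q^-1 ^+ y.+1 ^+ h * qint q^-1 y.+2 ^+ m) N +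
    (u N - altsum (fun y => q^-1 ^+ y.+1 ^+ h * qint q^-1 y.+2 ^+ m) N)).
  by apply/funext => N; rewrite addrC subrK.
rewrite -[X in _ --> X]addr0; apply: cvg_absvD => //.
apply: cvg_absv_le (absv_ppow_cvg0 p_prime C) => N; rewrite subr0.
rewrite /u altsum_rev// /altsum -sumrB; apply: absv_sum_nat_le => [|y /andP[_ yM]].
  exact: absv_ge0.
rewrite -mulrBr absvM absv_sign mul1r; set M := (p ^ N)%N in yM *.
set x := (M - y.+1)%N.
have xy : M = (y.+1 + x)%N by rewrite /x subnKC.
have qy0 : q ^+ y.+1 != 0 by rewrite expf_neq0.
have qxE : q ^+ x = q^-1 ^+ y.+1 * q ^+ M.
  by rewrite xy exprD mulrA -exprMn mulVf// expr1n mul1r.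
have bE : 1 - qint q x = qint q^-1 y.+2 - q^-1 ^+ y.+1 * qint q M.
  apply: (mulfI qy0); rewrite !mulrBr qintV// mulrA -exprMn divff// expr1n mul1r mulr1.
  by rewrite xy qintD qintS; ring.
have qV_le1 n : absv (q^-1 ^+ n) = 1 by rewrite absv_qpow.
have b_le1 : absv (1 - qint q x) <= 1 by rewrite absvB_le ?absv1 ?absv_qint_le1.
apply: absv_mulB_le; first by rewrite absvX_le1// absv_qpow.
- by rewrite absvX_le1// absv_qint_le1.
- rewrite absv_exprB_le ?absv_ge0 ?qV_le1 ?absv_qpow// qxE.
  rewrite -[X in _ - X]mulr1 -mulrBr absvM qV_le1 mul1r.
  exact: absv_expr_sub1_le.
- rewrite absv_exprB_le ?absv_ge0 ?absv_qint_le1// bE addrAC subrr add0r absvN.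
  by rewrite absvM qV_le1 mul1r absv_qint.
Qed.

(** With J the limit of alternating sums and phi(y) = q^(-hy) [y]_{1/q}^m, the
    reflection gives q^h J(phi(y + 2)), and two shifts replace this by
    q^h (J(phi) + 2 phi(1) - 2 phi(0)); here phi(0) = 0 because m > 0. *)
Lemma cvg_altsum_moment h m : (0 < m)%N -> (0 < h)%N ->
  altsum (fun x => q ^+ x ^+ h * (1 - qint q x) ^+ m) @ \oo -->
  2 + q ^+ h.+1 * 2 / (1 + q) * (genocchi h q^-1 m.+1 / m.+1%:R).
Proof.
move=> m0 h0; pose phi y := q^-1 ^+ y ^+ h * qint q^-1 y ^+ m.
have phiL : padic_lipschitz phi.
  apply: padic_lipschitzM; apply: padic_lipschitzX.
    exact: padic_lipschitz_pow.
  exact: padic_lipschitz_qint.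
have phis := cvg_altsum p_prime p_odd phiL; set s := limn _ in phis.
have two0 : (2 : C) != 0 by rewrite -absv_eq0 absv2 oner_eq0.
have q1 : 1 + q != 0.
  by rewrite -absv_eq0 -[q in 1 + q]expr1 (absv_1Dexpr hq) oner_eq0.
have gE : genocchi h q^-1 m.+1 / m.+1%:R = (1 + q^-1) / 2 * s.
  rewrite /genocchi /genocchi_poly mulrAC divff ?natC_neq0// mul1r.
  apply: (fermionic_intE hqV _ phis) => x.
  rewrite add0r -natrM qpow_nat// qnum_nat// mulrAC -exprD addnC -mulSn prednK//.
  by rewrite mulnC exprM.
have sE : 2 + q ^+ h.+1 * 2 / (1 + q) * (genocchi h q^-1 m.+1 / m.+1%:R) =
    q ^+ h * (2 * phi 1%N - (2 * phi 0%N - s)).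
  rewrite gE /phi expr0 qint0 qint1 expr1n expr0n (gtn_eqF m0) !expr1n expr1.
  rewrite exprVn exprS /= mulr0n; field.
  by rewrite q0 two0 expf_neq0.
rewrite sE; apply: cvg_altsum_reflect.
have phi2 := cvg_altsum_shift p_prime p_odd (padic_lipschitz_shift phiL)
  (cvg_altsum_shift p_prime p_odd phiL phis).
have -> : altsum (fun y => q^-1 ^+ y.+1 ^+ h * qint q^-1 y.+2 ^+ m) =
    (fun N => q ^+ h * altsum ((phi \o succn) \o succn) N).
  apply/funext => N; rewrite /altsum mulr_sumr; apply: eq_bigr => y _ /=.
  rewrite /phi [q^-1 ^+ y.+2]exprS exprMn [RHS]mulrCA; congr (_ * _).
  by rewrite !mulrA -exprMn divff// expr1n mul1r.
exact: cvg_absvMl.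
Qed.

End Reflection.
End Integral.

(** * The integral of a product of two Bernstein polynomials *)

Theorem theorem7 (R : realType) (p : nat) (p_prime : prime p) (p_odd : odd p)
    (C : padic_complex R p) (q : C)
    (hq : absv (1 - q) < (p%:R : R) `^ (- (p.-1%:R)^-1))
    (h : nat) (h_gt0 : (0 < h)%N)
    (n1 n2 k : nat) (hn : (2 * k < n1 + n2)%N) :
  fermionic_int q (fun x : C =>
    qbernstein k n1 x q * qbernstein k n2 x q * qpow q (h.-1%:R * x)) =
  if k == 0%N then
    qnum q 2%:R
    + q ^+ h.+1 / (n1 + n2 + 1)%:R * genocchi h q^-1 (n1 + n2 + 1)
  else
    'C(n1, k)%:R * 'C(n2, k)%:R *
    \sum_(0 <= l < (2 * k).+1)
      'C(2 * k, l)%:R * (-1) ^+ (2 * k + l) *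
      (qnum q 2%:R
       + q ^+ h.+1 / (n1 + n2 - l + 1)%:R * genocchi h q^-1 (n1 + n2 - l + 1)).
Proof.
rewrite -/(exp_radius R p) in hq.
set value := fun m => qnum q 2%:R + q ^+ h.+1 / (m + 1)%:R * genocchi h q^-1 (m + 1).
set rhs := 'C(n1, k)%:R * 'C(n2, k)%:R * \sum_(0 <= l < (2 * k).+1)
      'C(2 * k, l)%:R * (-1) ^+ (2 * k + l) * value (n1 + n2 - l)%N.
(* for k = 0 the sum over l reduces to its term l = 0 *)
transitivity rhs; last first.
  case: eqP => // k0; rewrite /rhs k0 muln0 !bin0 big_nat1 bin0 expr0 subn0.
  by rewrite !mul1r.
pose moment m x := q ^+ x ^+ h * (1 - qint q x) ^+ m.
pose c l : C := 'C(2 * k, l)%:R * (-1) ^+ (2 * k + l).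
pose g x := 'C(n1, k)%:R * 'C(n2, k)%:R *
  \sum_(0 <= l < (2 * k).+1) c l * moment (n1 + n2 - l)%N x.
have two0 : (2 : C) != 0 by rewrite -absv_eq0 absv2// oner_eq0.
have q1 : 1 + q != 0.
  by rewrite -absv_eq0 -[q in 1 + q]expr1 (absv_1Dexpr p_prime p_odd hq) oner_eq0.
pose lim_moment m : C := 2 + q ^+ h.+1 * 2 / (1 + q) * (genocchi h q^-1 m.+1 / m.+1%:R).
have valueE m : value m = (1 + q) / 2 * lim_moment m.
  rewrite /value /lim_moment addn1 (qnum_nat p_prime p_odd hq) qintS qint1 expr1.
  move: (genocchi _ _ _) (m.+1%:R : C) (natC_neq0 p_prime C (ltn0Sn m)) => G d d0.
  by field; rewrite d0 q1 two0.
have rhsE : rhs = (1 + q) / 2 *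
    ('C(n1, k)%:R * 'C(n2, k)%:R *
     \sum_(0 <= l < (2 * k).+1) c l * lim_moment (n1 + n2 - l)%N).
  rewrite mulrCA /rhs; congr (_ * _); rewrite mulr_sumr; apply: eq_bigr => l _.
  by rewrite valueE mulrCA.
rewrite rhsE; apply: (@fermionic_intE _ _ p_prime p_odd _ _ hq _ g).
  move=> x; rewrite /qbernstein -natrM (qpow_nat p_prime p_odd hq).
  rewrite (qnum_nat p_prime p_odd hq) (qnum_1B p_prime p_odd _ hq) /g.
  have [kn1|n1k] := leqP k n1; last by rewrite (bin_small n1k) !mul0r.
  have [kn2|n2k] := leqP k n2; last by rewrite (bin_small n2k) !(mul0r, mulr0).
  set a := qint q x; rewrite /moment -/a.
  have -> : \sum_(0 <= l < (2 * k).+1) c l * (q ^+ x ^+ h * (1 - a) ^+ (n1 + n2 - l)) =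
      a ^+ (2 * k) * (1 - a) ^+ (n1 - k + (n2 - k)) * q ^+ x ^+ h.
    have -> : a ^+ (2 * k) = (- (1 - a) + 1) ^+ (2 * k) by rewrite opprB subrK.
    rewrite exprDn 2!mulr_suml big_mkord; apply: eq_bigr => -[l l_lt] _ /=.
    have -> : (n1 + n2 - l = 2 * k - l + (n1 - k + (n2 - k)))%N by lia.
    (* 2k - l and 2k + l have the same parity *)
    have -> : c l = 'C(2 * k, l)%:R * (-1) ^+ (2 * k - l).
      by congr (_ * _); rewrite -[LHS]signr_odd -[RHS]signr_odd oddD oddB.
    by rewrite (exprNn (1 - a)) expr1n -mulr_natl exprD; ring.
  rewrite -[X in _ ^+ x ^+ X](prednK h_gt0) exprS (mulnC h.-1) exprM.
  by rewrite mul2n -addnn !exprD; ring.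
have -> : altsum g = (fun N => 'C(n1, k)%:R * 'C(n2, k)%:R *
    \sum_(0 <= l < (2 * k).+1) c l * altsum (moment (n1 + n2 - l)%N) N).
  apply/funext => N; rewrite /altsum /g.
  under eq_bigr do rewrite mulrCA mulr_sumr.
  rewrite -mulr_sumr exchange_big/=; congr (_ * _); apply: eq_bigr => l _.
  by rewrite mulr_sumr; apply: eq_bigr => x _; rewrite mulrCA.
apply: cvg_absvMl; under eq_fun do rewrite big_mkord.
rewrite big_mkord; apply: cvg_absv_sum => -[l l_lt] /=; apply: cvg_absvMl.
by apply: cvg_altsum_moment => //; lia.
Qed.
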